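(* For all integers $m,n\ge 1$, the characteristic polynomials $P(\mathrm{EC}_{m,n};x)$ and $P(\mathrm{OC}_{m,n};x)$ satisfy $$P(\mathrm{EC}_{m,n};x)\,P(\mathrm{OC}_{m,n};x)=\prod_{j=1}^m\;\prod_{k=1}^n\left(x-4\cos\frac{j\pi}{m+1}\,\cos\frac{k\pi}{n+1}\right)$$ and $$P(\mathrm{EC}_{m,n};x)=x^{\,mn \bmod 2}\,P(\mathrm{OC}_{m,n};x),$$ where $mn \bmod 2\in\{0,1\}$ is the remainder of $mn$ modulo $2$.
   Context: For a graph $\Gamma$, $P(\Gamma;x)$ denotes the (monic) characteristic polynomial $\det(xI-A)$ of its adjacency matrix $A$; for the graph with no vertices it equals $1$. For integers $m,n$, consider the graph on the vertex set $\{(x,y)\in\mathbb{Z}^2 : 1\le x\le m,\ 1\le y\le n\}$ in which $(x,y)$ is adjacent to $(x',y')$ if and only if $|x-x'|=|y-y'|=1$. $\mathrm{EC}_{m,n}$ is its induced subgraph on the vertices with $x+y$ even, and $\mathrm{OC}_{m,n}$ is its induced subgraph on the vertices with $x+y$ odd. *)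

(* Defs.v *)
From HB Require Import structures.
From mathcomp Require Import all_boot all_order all_algebra.
From mathcomp Require Import all_classical all_reals all_analysis.

Set Implicit Arguments.
Unset Strict Implicit.
Unset Printing Implicit Defensive.

Import Order.TTheory GRing.Theory Num.Theory.
Local Open Scope ring_scope.

(* A finite simple graph is a symmetric irreflexive relation on a finType. *)

Section Graphs.
Variables (R : nzRingType) (T : finType).

Definition adjmx (e : rel T) : 'M[R]_#|T| :=
  \matrix_(i, j) (e (enum_val i) (enum_val j))%:R.

Definition induced (e : rel T) (S : {set T}) : rel {v : T | v \in S} :=
  fun u v => e (val u) (val v).

End Graphs.

Arguments induced {T} e S _ _.

Definition graph_char_poly (R : comNzRingType) (T : finType) (e : rel T) :
  {poly R} := char_poly (adjmx R e).

(* 'I_m is {0, ..., m - 1}: the pair (i, j) : 'I_m * 'I_n stands for the grid *)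
(* point (x, y) = (i + 1, j + 1).                                             *)

Section Grid.
Variables m n : nat.

Definition xcoord (v : 'I_m * 'I_n) : nat := v.1.+1.
Definition ycoord (v : 'I_m * 'I_n) : nat := v.2.+1.

Definition diag_adj : rel ('I_m * 'I_n) := fun u v =>
  (`|(xcoord u)%:Z - (xcoord v)%:Z| == 1) &&
  (`|(ycoord u)%:Z - (ycoord v)%:Z| == 1).

Lemma diag_adj_sym : symmetric diag_adj.
Proof. by move=> u v; rewrite /diag_adj distrC [X in _ && (X == _)]distrC. Qed.

Lemma diag_adj_irr : irreflexive diag_adj.
Proof. by move=> u; rewrite /diag_adj subrr normr0. Qed.

Definition even_points : {set 'I_m * 'I_n} :=
  [set v | ~~ odd (xcoord v + ycoord v)].
Definition odd_points : {set 'I_m * 'I_n} :=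
  [set v | odd (xcoord v + ycoord v)].

Definition EC : rel {v | v \in even_points} := induced diag_adj even_points.
Definition OC : rel {v | v \in odd_points} := induced diag_adj odd_points.

End Grid.

Arguments EC m n _ _ : clear implicits.
Arguments OC m n _ _ : clear implicits.

(* Main.v *)
Require Import Defs.
From HB Require Import structures.
From mathcomp Require Import all_boot all_order all_algebra.
From mathcomp Require Import all_classical all_reals all_analysis.
From mathcomp Require Import ring zify.

Set Implicit Arguments.
Unset Strict Implicit.
Unset Printing Implicit Defensive.

Import Order.TTheory GRing.Theory Num.Theory.
Local Open Scope ring_scope.

(** Write A for the adjacency matrix of the whole graph on the grid, M for the
    matrix of horizontal unit steps (an edge of the path on m vertices in the
    first coordinate, the second one kept) and N for that of vertical unit
    steps.  A diagonal step is a horizontal step followed by a vertical one, or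
    the other way round, so A = M N = N M; in other words A is the tensor
    product of the adjacency matrices of the two paths.

    Product formula.  A diagonal step preserves the parity of x + y, so A is
    block diagonal and its characteristic polynomial is the product of those of
    EC and OC ([char_poly_split]).  The path on n vertices has the eigenvectors
    i |-> sin (i j pi / (n + 1)) with the eigenvalues 2 cos (j pi / (n + 1));
    these are distinct, so by symmetry the eigenvectors are orthogonal
    ([path_eigenvector_orth]).  Products of path eigenvectors thus form an
    orthogonal eigenbasis of the tensor product A, whose eigenvalues are the
    products of path eigenvalues ([char_poly_grid]).

    Comparison of EC and OC.  M and N each exchange even and odd points.  Hence
    the even block of A is M_eo N_oe, and its odd block is N_oe M_eo, with
    the same two rectangular matrices.  As X Y and Y X have the same
    characteristic polynomial up to a power of the variable
    ([char_poly_mulmxC]), so do EC and OC ([char_poly_commuting_swaps]).  The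
    exponent is the difference between the numbers of even and odd points,
    which is mn mod 2 ([card_even_odd_points]). *)

(** * The characteristic polynomials of XY and YX *)

(** Both sides equal x ^ q times the determinant of the matrix K with the blocks
    x, A, B, 1: clearing the lower left block by column operations
    leaves the Schur complement x - A B, and clearing it by row operations, at
    the cost of a factor x on the lower rows, leaves x - B A. *)
Lemma char_poly_mulmxC (R : comNzRingType) p q (A : 'M[R]_(p, q))
    (B : 'M[R]_(q, p)) :
  'X^q * char_poly (A *m B) = 'X^p * char_poly (B *m A).
Proof.
pose A' := map_mx polyC A; pose B' := map_mx polyC B.
pose K : 'M[{poly R}]_(p + q) := block_mx 'X%:M A' B' 1%:M.
have detK : \det K = char_poly (A *m B).
  have KL : K *m block_mx 1%:M 0 (- B') 1%:M =
            block_mx (char_poly_mx (A *m B)) A' 0 1%:M.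
    rewrite mulmx_block !mulmx1 !mulmx0 !mul1mx mulmxN add0r subrr add0r.
    by rewrite /char_poly_mx map_mxM.
  have := congr1 determinant KL.
  by rewrite det_mulmx det_lblock det_ublock !det1 !mulr1.
have LK : block_mx 1%:M 0 (- B') 'X%:M *m K =
          block_mx 'X%:M A' 0 (char_poly_mx (B *m A)).
  rewrite mulmx_block !mul1mx !mul0mx !mulmx1 !addr0 mulNmx -scalar_mxC.
  by rewrite addNr /char_poly_mx map_mxM mulNmx addrC.
have := congr1 determinant LK.
by rewrite det_mulmx det_lblock det_ublock det1 mul1r !det_scalar detK.
Qed.

Lemma char_poly_mulmxC_square (R : idomainType) p q (A : 'M[R]_(p, q))
    (B : 'M[R]_(q, p)) :
  p = q -> char_poly (A *m B) = char_poly (B *m A).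
Proof.
move=> epq; apply: (@mulfI _ 'X^p); first by rewrite monic_neq0 ?monicXn.
by rewrite -(char_poly_mulmxC A B); congr (_ * _); rewrite epq.
Qed.

(** * Matrices indexed by finite types *)

Section FinTypeMatrix.
Variable R : comNzRingType.

Definition fmx (T U : finType) (F : T -> U -> R) : 'M[R]_(#|T|, #|U|) :=
  \matrix_(i, j) F (enum_val i) (enum_val j).

Lemma eq_fmx (T U : finType) (F G : T -> U -> R) :
  (forall t u, F t u = G t u) -> fmx F = fmx G.
Proof. by move=> eFG; apply/matrixP=> i j; rewrite !mxE. Qed.

Lemma mul_fmx (T U V : finType) (F : T -> U -> R) (G : U -> V -> R) :
  fmx F *m fmx G = fmx (fun t v => \sum_u F t u * G u v).
Proof.
apply/matrixP=> i j; rewrite !mxE.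
rewrite [RHS](reindex (@enum_val U predT)); last exact/onW_bij/enum_val_bij.
by apply: eq_bigr => k _; rewrite !mxE.
Qed.

Lemma fmx1 (T : finType) : fmx (fun t u : T => (t == u)%:R) = 1%:M.
Proof.
by apply/matrixP=> i j; rewrite !mxE (inj_eq enum_val_inj).
Qed.

Lemma sum_deltal (T : finType) (t : T) (f : T -> R) :
  \sum_u (t == u)%:R * f u = f t.
Proof.
rewrite (bigD1 t) //= eqxx mul1r big1 ?addr0 // => u /negbTE.
by rewrite eq_sym => ->; rewrite mul0r.
Qed.

Lemma sum_deltar (T : finType) (t : T) (f : T -> R) :
  \sum_u f u * (u == t)%:R = f t.
Proof.
by rewrite -[RHS]sum_deltal; apply: eq_bigr => u _; rewrite mulrC eq_sym.
Qed.

Lemma char_poly_fmx_diag (T : finType) (d : T -> R) :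
  char_poly (fmx (fun t u => d t * (t == u)%:R)) = \prod_t ('X - (d t)%:P).
Proof.
rewrite char_poly_trig; last first.
  apply/is_trig_mxP => i j ltij; rewrite mxE (inj_eq enum_val_inj).
  by case: eqP ltij => [->|_ _]; rewrite ?ltnn ?mulr0.
rewrite [RHS](reindex (@enum_val T predT)); last exact/onW_bij/enum_val_bij.
by apply: eq_bigr => i _; rewrite mxE eqxx mulr1.
Qed.

Definition restr (T : finType) (F : T -> T -> R) (S1 S2 : {set T}) :
    {v | v \in S1} -> {v | v \in S2} -> R :=
  fun u v => F (val u) (val v).

End FinTypeMatrix.

Arguments restr {R T} F S1 S2 _ _.

(** Orthogonality makes the transpose of V, with its columns divided by c, an
    inverse of V; since the rows of V are left eigenvectors, V conjugates F to
    the diagonal matrix of the d j. *)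
Lemma char_poly_orthogonal_eigenbasis (K : fieldType) (T : finType)
    (F V : T -> T -> K) (c d : T -> K) :
  (forall j t, \sum_u V j u * F u t = d j * V j t) ->
  (forall j k, \sum_t V j t * V k t = c j * (j == k)%:R) ->
  (forall j, c j != 0) ->
  char_poly (fmx F) = \prod_j ('X - (d j)%:P).
Proof.
move=> eigV orthV c_neq0.
pose W t j := V j t / c j.
have VW : fmx V *m fmx W = 1%:M.
  rewrite mul_fmx -fmx1; apply: eq_fmx => j k.
  under eq_bigr do rewrite mulrA.
  rewrite -mulr_suml orthV mulrAC; case: eqP => [->|_]; last by rewrite mulr0.
  by rewrite divff ?mulr1.
have VF : fmx V *m fmx F = fmx (fun t u => d t * (t == u)%:R) *m fmx V.
  rewrite !mul_fmx; apply: eq_fmx => j t; rewrite eigV.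
  under [RHS]eq_bigr do rewrite -mulrA.
  by rewrite -mulr_sumr sum_deltal.
have -> : fmx F = fmx W *m (fmx V *m fmx F).
  by rewrite mulmxA (mulmx1C VW) mul1mx.
by rewrite char_poly_mulmxC_square // VF -mulmxA VW mulmx1 char_poly_fmx_diag.
Qed.

(** The enumeration of T need not list S1 before S2, so the block diagonal form
    is reached by a change of basis: the inclusions of S1 and S2 into T,
    side by side, form a permutation matrix P with inverse Q. *)
Lemma char_poly_split (K : idomainType) (T : finType) (F : T -> T -> K)
    (S1 S2 : {set T}) :
  S2 = ~: S1 ->
  (forall u v, (u \in S1) != (v \in S1) -> F u v = 0) ->
  char_poly (fmx F) =
    char_poly (fmx (restr F S1 S1)) *
    char_poly (fmx (restr F S2 S2)).
Proof.
move=> defS2 F0.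
pose incl (S : {set T}) : T -> {v | v \in S} -> K := fun t u => (t == val u)%:R.
pose proj (S : {set T}) : {v | v \in S} -> T -> K := fun u t => (val u == t)%:R.
have restrE S S' : fmx (@proj S) *m fmx F *m fmx (@incl S') =
    fmx (restr F S S').
  rewrite !mul_fmx; apply: eq_fmx => u v; rewrite sum_deltar.
  by rewrite sum_deltal.
have inclK S : fmx (@incl S) *m fmx (@proj S) =
    fmx (fun t u => (t == u)%:R * (t \in S)%:R).
  rewrite mul_fmx; apply: eq_fmx => t u.
  rewrite -(big_sub S (fun x => (t == x)%:R * (x == u)%:R)).
  rewrite big_mkcond /=
    -[RHS](sum_deltal t (fun x => (x == u)%:R * (x \in S)%:R)).
  by apply: eq_bigr => x _; case: ifP; rewrite ?mulr1 ?mulr0.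
pose P := row_mx (fmx (@incl S1)) (fmx (@incl S2)).
pose Q := col_mx (fmx (@proj S1)) (fmx (@proj S2)).
have PQ : P *m Q = 1%:M.
  rewrite mul_row_col !inclK -fmx1; apply/matrixP => i j; rewrite !mxE.
  by rewrite -mulrDr defS2 inE; case: (_ \in S1); rewrite ?addr0 ?add0r mulr1.
have -> : fmx F = P *m (Q *m fmx F) by rewrite mulmxA PQ mul1mx.
rewrite char_poly_mulmxC_square; last first.
  by rewrite !card_sig -(cardsC S1) defS2 !cardsE.
rewrite mul_col_mx mul_col_row !restrE /char_poly.
have restr0 (A B : {set T}) : (forall u v, u \in A -> v \in B ->
    (u \in S1) != (v \in S1)) -> fmx (restr F A B) = 0.
  move=> AB; apply/matrixP=> i j; rewrite !mxE /restr F0 //.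
  by apply: AB; apply: valP.
rewrite (restr0 S1 S2) ?(restr0 S2 S1).
- by rewrite char_block_diag_mx det_ublock.
- by rewrite defS2 => u v; rewrite inE => /negbTE-> ->.
- by rewrite defS2 => u v; rewrite inE => -> /negbTE->.
Qed.

(** The blocks of F on S1 and on S2 are X Y and Y X, where X is the block of M
    from S1 to S2 and Y the block of N from S2 to S1: for X Y this is F = M N,
    for Y X it is F = N M, and the swap hypotheses make the intermediate sums
    over T range over one part only. *)
Lemma char_poly_commuting_swaps (K : comNzRingType) (T : finType)
    (F M N : T -> T -> K) (S1 S2 : {set T}) :
  S2 = ~: S1 ->
  (forall u v, (u \in S1) = (v \in S1) -> M u v = 0) ->
  (forall u v, (u \in S1) = (v \in S1) -> N u v = 0) ->
  (forall u w, \sum_v M u v * N v w = F u w) ->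
  (forall u w, \sum_v N u v * M v w = F u w) ->
  'X^(#|S2|) * char_poly (fmx (restr F S1 S1)) =
  'X^(#|S1|) * char_poly (fmx (restr F S2 S2)).
Proof.
move=> defS2 M0 N0 MN NM.
have mulE (A B : {set T}) (G H : T -> T -> K) :
    (forall u v, u \in A -> v \notin B -> G u v = 0) ->
    (forall u w, \sum_v G u v * H v w = F u w) ->
  fmx (restr G A B) *m fmx (restr H B A) =
  fmx (restr F A A).
  move=> G0 GH; rewrite mul_fmx; apply: eq_fmx => u w; rewrite /restr -GH.
  rewrite -(big_sub B (fun x => G (val u) x * H x (val w))) big_mkcond /=.
  apply: eq_bigr => v _; case: ifPn => // vB.
  by rewrite G0 ?mul0r //; apply: valP.
rewrite -(mulE S1 S2 M N) -?(mulE S2 S1 N M) //.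
- have cS (S : {set T}) : #|{: {v | v \in S}}| = #|S|.
    by rewrite card_sig; apply: eq_card => x.
  by rewrite -(cS S1) -(cS S2) char_poly_mulmxC.
- move=> u v; rewrite defS2 inE => /negbTE uS /negbTE vS.
  by apply: N0; rewrite uS vS.
- by move=> u v uS; rewrite defS2 inE negbK => vS; apply: M0; rewrite uS vS.
Qed.

(** * Spectrum of the path *)

Definition path_adj (n : nat) : rel 'I_n :=
  fun i j => `|i.+1%:Z - j.+1%:Z| == 1.

Lemma path_adjC n (i j : 'I_n) : path_adj i j = path_adj j i.
Proof. by rewrite /path_adj distrC. Qed.

Lemma path_adj_parity n (i j : 'I_n) : path_adj i j -> odd i = ~~ odd j.
Proof. rewrite /path_adj; lia. Qed.

(** The values of f at 0 and n.+1 are those at the two phantom neighbours of the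
    end vertices; since they vanish, the ends need no separate treatment. *)
Lemma sum_path_adj (R : comNzRingType) n (f : nat -> R) (i : 'I_n) :
  f 0%N = 0 -> f n.+1 = 0 ->
  \sum_(j < n) f j.+1 * (path_adj j i)%:R = f i + f i.+2.
Proof.
move=> f0 fn.
have sum_nat_delta (k : nat) :
    \sum_(j < n) f j.+1 * (j.+1 == k)%:R = if (k <= n)%N then f k else 0.
  case: k => [|k].
    by rewrite big1 ?f0 // => j _; rewrite mulr0.
  case: ltnP => [ltkn|lenk].
    rewrite -[RHS](sum_deltar (Ordinal ltkn) (fun j : 'I_n => f j.+1)).
    by apply: eq_bigr => j _; rewrite eqSS -val_eqE.
  rewrite big1 // => j _; case: eqP => [[ejk]|_]; last by rewrite mulr0.
  by have := ltn_ord j; rewrite ejk ltnNge lenk.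
have splitE (j : 'I_n) :
    (path_adj j i)%:R = (j.+1 == i)%:R + (j.+1 == i.+2)%:R :> R.
  rewrite -natrD; congr (_%:R); rewrite /path_adj; lia.
under eq_bigr do rewrite splitE mulrDr.
rewrite big_split /= !sum_nat_delta (ltnW (ltn_ord i)); congr (_ + _).
case: ltnP => // leni; have /eqP -> : i.+1 == n by rewrite eqn_leq leni ltn_ord.
by [].
Qed.

Section PathSpectrum.
Variables (R : realType) (n : nat).

Let theta : R := pi / n.+1%:R.

(** Both the vertices and the eigenvectors are numbered from 0, hence the
    successors. *)
Definition path_eigenvector (j i : 'I_n) : R := sin ((j.+1 * i.+1)%:R * theta).

Definition path_eigenvalue (j : 'I_n) : R := 2 * cos (j.+1%:R * pi / n.+1%:R).

(** This is sin (a - b) + sin (a + b) = 2 cos b sin a; the boundary terms are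
    sin 0 and sin ((j + 1) pi). *)
Lemma path_eigenvectorP j i :
  \sum_k path_eigenvector j k * (path_adj k i)%:R =
  path_eigenvalue j * path_eigenvector j i.
Proof.
rewrite (@sum_path_adj _ _ (fun k => sin ((j.+1 * k)%:R * theta))).
- have -> : (j.+1 * i)%:R * theta = (j.+1 * i.+1)%:R * theta - j.+1%:R * theta.
    by rewrite -mulrBl mulnS natrD addrAC subrr add0r.
  have -> : (j.+1 * i.+2)%:R * theta = (j.+1 * i.+1)%:R * theta + j.+1%:R * theta.
    by rewrite -mulrDl -natrD mulnS addnC.
  rewrite sinB sinD /path_eigenvector /path_eigenvalue -[j.+1%:R * pi / _]mulrA.
  by rewrite -/theta; ring.
- by rewrite muln0 mul0r sin0.
- have -> : (j.+1 * n.+1)%:R * theta = 0 + pi *+ j.+1.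
    by rewrite /theta add0r natrM -mulrA [X in _ * X]mulrCA divff ?pnatr_eq0 //
      mulr1 mulr_natl.
  by rewrite (alternatingn (@sinDpi R)) sin0 mulr0.
Qed.

Lemma path_angle_bounds (j : 'I_n) : 0 < j.+1%:R * theta < pi.
Proof.
have := pi_gt0 R => pi0; rewrite /theta mulr_gt0 ?divr_gt0 ?ltr0Sn //=.
by rewrite mulrA ltr_pdivrMr ?ltr0Sn // mulrC ltr_pM2l // ltr_nat ltnS.
Qed.

Lemma path_eigenvalue_inj : injective path_eigenvalue.
Proof.
move=> j k; rewrite /path_eigenvalue -!mulrA => /mulfI; rewrite pnatr_eq0.
move=> /(_ isT) /cos_inj; rewrite !in_itv /=.
have /andP[/ltW -> /ltW ->] := path_angle_bounds j.
have /andP[/ltW -> /ltW ->] := path_angle_bounds k.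
move=> /(_ isT isT) /mulIf.
rewrite mulf_neq0 ?invr_eq0 ?pnatr_eq0 ?gt_eqF ?pi_gt0 //.
by move=> /(_ isT) /eqP; rewrite eqr_nat eqSS => /eqP /val_inj.
Qed.

Definition path_sqnorm (j : 'I_n) : R := \sum_i path_eigenvector j i ^+ 2.

(** At the first vertex the eigenvector takes the value sin ((j + 1) theta),
    whose angle lies strictly between 0 and pi. *)
Lemma path_sqnorm_neq0 j : path_sqnorm j != 0.
Proof.
have n_gt0 : (0 < n)%N by apply: leq_ltn_trans (ltn_ord j).
rewrite /path_sqnorm (bigD1 (Ordinal n_gt0)) //= gt_eqF // ltr_pwDl //.
  by rewrite exprn_gt0 // /path_eigenvector muln1 sin_gt0_pi ?path_angle_bounds.
by rewrite sumr_ge0 // => i _; rewrite sqr_ge0.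
Qed.

(** Eigenvectors of a symmetric matrix for distinct eigenvalues are orthogonal:
    the bilinear form of the path, taken at both vectors, is their inner product
    s times either eigenvalue.  This avoids evaluating trigonometric sums. *)
Lemma path_eigenvector_orth j k :
  \sum_i path_eigenvector j i * path_eigenvector k i =
  path_sqnorm j * (j == k)%:R.
Proof.
case: eqVneq => [<-|neq_jk].
  by rewrite mulr1; apply: eq_bigr => i _; rewrite expr2.
rewrite mulr0; set s := LHS.
have e1 : \sum_i \sum_l path_eigenvector j l * (path_adj l i)%:R *
    path_eigenvector k i = path_eigenvalue j * s.
  rewrite /s mulr_sumr; apply: eq_bigr => i _.
  by rewrite -mulr_suml path_eigenvectorP mulrA.
have e2 : \sum_i \sum_l path_eigenvector j l * (path_adj l i)%:R *
    path_eigenvector k i = path_eigenvalue k * s.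
  rewrite exchange_big /s mulr_sumr; apply: eq_bigr => l _.
  rewrite [RHS]mulrCA -path_eigenvectorP mulr_sumr; apply: eq_bigr => i _.
  by rewrite path_adjC; ring.
have /eqP : (path_eigenvalue j - path_eigenvalue k) * s = 0.
  by rewrite mulrBl -e1 -e2 subrr.
by rewrite mulf_eq0 subr_eq0 (inj_eq path_eigenvalue_inj) (negbTE neq_jk) => /eqP.
Qed.

End PathSpectrum.

(** * The grid as a tensor product of two paths *)

Section GridSpectrum.
Variables (R : realType) (m n : nat).
Local Notation grid := ('I_m * 'I_n)%type.

Definition grid_weight (u v : grid) : R := (@diag_adj m n u v)%:R.

Lemma grid_weightE u v :
  grid_weight u v = (path_adj u.1 v.1)%:R * (path_adj u.2 v.2)%:R.
Proof. by rewrite /grid_weight -natrM mulnb. Qed.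

Lemma sum_grid_mul (f : 'I_m -> R) (g : 'I_n -> R) :
  \sum_(v : grid) f v.1 * g v.2 = (\sum_i f i) * (\sum_j g j).
Proof.
rewrite mulr_suml -(pair_bigA _ (fun i j => f i * g j)) /=.
by apply: eq_bigr => i _; rewrite mulr_sumr.
Qed.

Lemma char_poly_grid :
  char_poly (fmx grid_weight) = \prod_(v : grid)
    ('X - (path_eigenvalue R v.1 * path_eigenvalue R v.2)%:P).
Proof.
apply: (@char_poly_orthogonal_eigenbasis _ _ _
   (fun v u => path_eigenvector R v.1 u.1 * path_eigenvector R v.2 u.2)
   (fun v => path_sqnorm R v.1 * path_sqnorm R v.2)) => [j t|j k|j].
- rewrite mulrACA -!path_eigenvectorP -sum_grid_mul.
  by apply: eq_bigr => u _; rewrite grid_weightE mulrACA.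
- under eq_bigr do rewrite mulrACA.
  rewrite (sum_grid_mul (fun x => path_eigenvector R j.1 x * path_eigenvector R k.1 x)
    (fun y => path_eigenvector R j.2 y * path_eigenvector R k.2 y)).
  by rewrite !path_eigenvector_orth mulrACA -natrM mulnb.
- by rewrite mulf_neq0 ?path_sqnorm_neq0.
Qed.

Definition hstep (u v : grid) : R := (path_adj u.1 v.1)%:R * (u.2 == v.2)%:R.
Definition vstep (u v : grid) : R := (u.1 == v.1)%:R * (path_adj u.2 v.2)%:R.

Lemma hstep_vstep u w : \sum_v hstep u v * vstep v w = grid_weight u w.
Proof.
under eq_bigr do rewrite mulrACA.
rewrite (sum_grid_mul (fun x => (path_adj u.1 x)%:R * (x == w.1)%:R)
  (fun y => (u.2 == y)%:R * (path_adj y w.2)%:R)).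
by rewrite sum_deltal sum_deltar grid_weightE.
Qed.

Lemma vstep_hstep u w : \sum_v vstep u v * hstep v w = grid_weight u w.
Proof.
under eq_bigr do rewrite mulrACA.
rewrite (sum_grid_mul (fun x => (u.1 == x)%:R * (path_adj x w.1)%:R)
  (fun y => (path_adj u.2 y)%:R * (y == w.2)%:R)).
by rewrite sum_deltal sum_deltar grid_weightE.
Qed.

Lemma in_even_points (v : grid) :
  (v \in even_points m n) = ~~ (odd v.1 (+) odd v.2).
Proof. by rewrite inE /xcoord /ycoord addSn addnS /= negbK oddD. Qed.

Lemma hstep_parity u v :
  (u \in even_points m n) = (v \in even_points m n) -> hstep u v = 0.
Proof.
rewrite !in_even_points /hstep; case: eqP => [->|_]; last by rewrite mulr0.
case: (boolP (path_adj _ _)) => [/path_adj_parity->|]; last by rewrite mul0r.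
by case: (odd v.1); case: (odd v.2).
Qed.

Lemma vstep_parity u v :
  (u \in even_points m n) = (v \in even_points m n) -> vstep u v = 0.
Proof.
rewrite !in_even_points /vstep; case: eqP => [->|_]; last by rewrite mul0r.
case: (boolP (path_adj _ _)) => [/path_adj_parity->|]; last by rewrite mulr0.
by case: (odd v.1); case: (odd v.2).
Qed.

Lemma grid_weight_parity u v :
  (u \in even_points m n) != (v \in even_points m n) -> grid_weight u v = 0.
Proof.
rewrite !in_even_points grid_weightE -natrM mulnb.
case: andP => [[/path_adj_parity-> /path_adj_parity->]|//].
by rewrite addNb addbN negbK eqxx.
Qed.

End GridSpectrum.

(** * Counting even and odd points *)

Lemma odd_pointsC m n : odd_points m n = ~: even_points m n.
Proof. by apply/setP => v; rewrite !inE negbK. Qed.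

Lemma sum_sign n : \sum_(i < n) (-1) ^+ i = (odd n)%:R :> int.
Proof.
elim: n => [|n IHn]; first by rewrite big_ord0.
by rewrite big_ord_recr /= IHn -signr_odd; case: (odd n).
Qed.

(** The difference is the sum of the signs of the points, which factors into the
    two alternating sums over the coordinates; each is 1 or 0 according to the
    parity of its length. *)
Lemma card_even_odd_points m n :
  #|even_points m n| = (#|odd_points m n| + (m * n) %% 2)%N.
Proof.
have : \sum_(v : 'I_m * 'I_n) (-1) ^+ (v.1 + v.2) =
    (#|even_points m n|%:R - #|odd_points m n|%:R : int).
  rewrite (bigID (mem (even_points m n))) /= -!sumr_const -sumrN odd_pointsC.
  congr (_ + _); first apply: eq_bigr => v.
    by rewrite in_even_points -signr_odd oddD; case: (_ (+) _).
  apply: eq_big => [v|v]; first by rewrite !inE.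
  by rewrite in_even_points -signr_odd oddD; case: (_ (+) _).
under eq_bigr do rewrite exprD.
rewrite -(pair_bigA _ (fun (i : 'I_m) (j : 'I_n) => (-1) ^+ i * (-1) ^+ j)) /=.
under eq_bigr do rewrite -mulr_sumr.
rewrite -mulr_suml !sum_sign -natrM mulnb -oddM modn2.
lia.
Qed.

Theorem corollary1 (R : realType) (m n : nat) (hm : (1 <= m)%N) (hn : (1 <= n)%N) :
  graph_char_poly R (EC m n) * graph_char_poly R (OC m n)
    = \prod_(1 <= j < m.+1) \prod_(1 <= k < n.+1)
        ('X - (4%:R * cos (j%:R * pi / m.+1%:R) * cos (k%:R * pi / n.+1%:R))%:P)
  /\ graph_char_poly R (EC m n)
    = 'X^((m * n) %% 2) * graph_char_poly R (OC m n).
Proof.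
have ecE : graph_char_poly R (EC m n) =
  char_poly (fmx (restr (@grid_weight R m n)
                        (even_points m n) (even_points m n))) by [].
have ocE : graph_char_poly R (OC m n) =
  char_poly (fmx (restr (@grid_weight R m n)
                        (odd_points m n) (odd_points m n))) by [].
split.
- rewrite ecE ocE -char_poly_split; [|exact: odd_pointsC|exact: grid_weight_parity].
  rewrite char_poly_grid big_add1 big_mkord.
  under [RHS]eq_bigr do rewrite big_add1 big_mkord.
  rewrite [RHS]pair_bigA /=; apply: eq_bigr => v _.
  by congr ('X - _%:P); rewrite /path_eigenvalue; ring.
- have := char_poly_commuting_swaps (odd_pointsC m n) (@hstep_parity R m n)
    (@vstep_parity R m n) (@hstep_vstep R m n) (@vstep_hstep R m n).
  rewrite -ecE -ocE card_even_odd_points exprD -mulrA.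
  by apply: mulfI; rewrite monic_neq0 ?monicXn.
Qed.
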